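(* Let $\mathcal{H}$ be a real Hilbert space and let $A:\mathcal{H}\to 2^{\mathcal{H}}$ be maximally monotone with $\operatorname{zer}A\neq\varnothing$. Let $(\lambda_k)_{k\in\mathbb{N}}$ be in $[0,2]$, $(\eta_k)_{k\in\mathbb{N}}$ in $\mathbb{R}_+$, $(c_k)_{k\in\mathbb{N}}$ in $\mathbb{R}_{++}$, $(e_k)_{k\in\mathbb{N}}$ in $\mathcal{H}$, and, for an initial point $x_0\in\mathcal{H}$, let $$(\forall k\in\mathbb{N})\quad x_{k+1}=(1-\lambda_k)x_k+\lambda_k \operatorname{J}_{c_kA}x_k+\eta_ke_k .$$ Let $\bar{x}\in\operatorname{zer}A$. Suppose that $A$ is metrically subregular at $\bar{x}$ for $0\in A\bar{x}$, i.e., there are $\kappa>0$ and $\delta>0$ (fixed from now on) such that $(\forall x\in B[\bar{x};\delta])$ $\operatorname{d}(x,A^{-1}0)\leq\kappa\operatorname{d}(0,Ax)$. Suppose that $c:=\inf_{k\in\mathbb{N}}c_k>0$ and that $\sum_{k\in\mathbb{N}}\eta_k\|e_k\|<\delta$. Let $0<\tau\leq\delta-\sum_{k\in\mathbb{N}}\eta_k\|e_k\|$ and let $x_0\in B[\bar{x};\tau]$. Define, for every $k\in\mathbb{N}$, $$y_k:=(1-\lambda_k)x_k+\lambda_k\operatorname{J}_{c_kA}x_k,\qquad \varepsilon_k:=\eta_k\|e_k\|\left(2\|y_k-\operatorname{P}_{\operatorname{zer}A}x_k\|+\eta_k\|e_k\|\right),$$ $$\gamma_k:=1+\frac{\kappa}{c_k},\qquad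 \beta_k:=\frac{\lambda_k(2-\lambda_k)}{\gamma_k^2},\qquad \rho_k:=1-\beta_k .$$ Set $\rho:=\sup_{k\in\mathbb{N}}\rho_k$, $\underline{\lambda}:=\inf_{k\in\mathbb{N}}\lambda_k$, $\overline{\lambda}:=\sup_{k\in\mathbb{N}}\lambda_k$. Then the following hold. (i) $(\forall k\in\mathbb{N})$ $\rho_k\in[0,1]$ and $\operatorname{d}^2(x_{k+1},\operatorname{zer}A)\leq\rho_k\operatorname{d}^2(x_k,\operatorname{zer}A)+\varepsilon_k$. (ii) $(\forall k\in\mathbb{N})$ $\operatorname{d}^2(x_{k+1},\operatorname{zer}A)\leq\left(\prod_{i=0}^{k}\rho_i\right)\operatorname{d}^2(x_0,\operatorname{zer}A)+\sum_{i=0}^{k}\left(\prod_{j=i+1}^{k}\rho_j\right)\varepsilon_i$. (iii) Suppose that $0<\underline{\lambda}\leq\overline{\lambda}<2$. Then: (a) $0\leq\rho\leq 1-\frac{\underline{\lambda}(2-\overline{\lambda})}{(1+\kappa/c)^2}<1$; (b) $(\forall k\in\mathbb{N})$ $\operatorname{d}^2(x_{k+1},\operatorname{zer}A)\leq\rho^k\left(\rho\operatorname{d}^2(x_0,\operatorname{zer}A)+\sum_{i=0}^{k}\frac{\varepsilon_i}{\rho^i}\right)$. Consequently, if $\sum_{k\in\mathbb{N}}\frac{\varepsilon_k}{\rho^k}<\infty$, then $(\operatorname{d}^2(x_k,\operatorname{zer}A))_{k\in\mathbb{N}}$ converges $R$-linearly to $0$. (iv) Suppose that $0<\underline{\lambda}\leq\overline{\lambda}<2$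 and that $e_k=0$ and $\eta_k=0$ for all $k\in\mathbb{N}$. Then: (a) $(\forall k\in\mathbb{N})$ $\operatorname{d}(x_{k+1},\operatorname{zer}A)\leq\rho_k^{1/2}\operatorname{d}(x_k,\operatorname{zer}A)$; (b) there exists $\hat{x}\in\operatorname{zer}A$ such that $(\forall k\in\mathbb{N})$ $\|x_k-\hat{x}\|\leq 2\rho^{k/2}\operatorname{d}(x_0,\operatorname{zer}A)$. Consequently, $(x_k)_{k\in\mathbb{N}}$ converges $R$-linearly to a point $\hat{x}\in\operatorname{zer}A$.
   Context: $\mathbb{N}=\{0,1,2,\ldots\}$; $\mathbb{R}_+$ and $\mathbb{R}_{++}$ are the nonnegative and positive reals. $\operatorname{zer}A=A^{-1}0=\{x\in\mathcal{H}:0\in Ax\}$; for maximally monotone $A$ it is closed and convex, and $\operatorname{P}_{\operatorname{zer}A}$ is the projector onto it. The resolvent is $\operatorname{J}_{\gamma A}=(\operatorname{Id}+\gamma A)^{-1}$, which for maximally monotone $A$ and $\gamma>0$ is single-valued with full domain. $B[\bar{x};r]$ is the closed ball of center $\bar{x}$ and radius $r$. $\operatorname{d}(x,C)=\inf_{y\in C}\|x-y\|$, with $\inf\varnothing=+\infty$; $\operatorname{d}^2$ denotes its square. Empty products equal $1$. A sequence $(y_k)_{k\in\mathbb{N}}$ converging to $\bar{y}$ converges $R$-linearly to $\bar{y}$ if $\limsup_{k\to\infty}\|y_k-\bar{y}\|^{1/k}<1$. *)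

(* Defs.v *)
From HB Require Import structures.
From mathcomp Require Import all_boot all_order all_algebra sesquilinear.
From mathcomp Require Import all_classical all_reals all_analysis.

Set Implicit Arguments.
Unset Strict Implicit.
Unset Printing Implicit Defensive.

Import Order.TTheory GRing.Theory Num.Theory.
Import numFieldNormedType.Exports.

Local Open Scope classical_set_scope.
Local Open Scope ring_scope.

(* A real Hilbert space is a complete normed module H together with a dot
   product inducing its norm. *)
Definition norm_induced_by (R : realType) (H : completeNormedModType R)
    (dot : {dot H for @idfun R}) : Prop :=
  forall u : H, `|u| = Num.sqrt (dot u u).

(* The infimum over the empty set is +oo. *)
Definition dist (R : realType) (V : normedModType R) (x : V) (C : set V)
    : \bar R :=
  ereal_inf [set `|x - y|%:E | y in C].

(* An operator A : H -> 2^H is a map A : H -> set H; u \in A x is [A x u]. *)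
Definition op_inv (U V : Type) (A : U -> set V) : V -> set U :=
  fun u => [set x | A x u].

Definition zer (R : realType) (H : normedModType R) (A : H -> set H) : set H :=
  op_inv A 0.

Definition monotone_op (R : realType) (H : completeNormedModType R)
    (dot : {dot H for @idfun R}) (A : H -> set H) : Prop :=
  forall x y u v : H, A x u -> A y v -> 0 <= dot (x - y) (u - v).

Definition maximally_monotone (R : realType) (H : completeNormedModType R)
    (dot : {dot H for @idfun R}) (A : H -> set H) : Prop :=
  monotone_op dot A /\
  forall B : H -> set H, monotone_op dot B ->
    (forall x, A x `<=` B x) -> forall x, B x `<=` A x.

(* The point of the set (Id + gamma A)^-1 x, which is a singleton when A is
   maximally monotone and gamma > 0; 0 is the default value when the set is
   empty. *)
Definition resolvent (R : realType) (H : normedModType R) (gamma : R)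
    (A : H -> set H) (x : H) : H :=
  xget 0 (op_inv (fun p => [set p + gamma *: u | u in A p]) x).

(* The projector onto C, meaningful when C is nonempty, closed and convex. *)
Definition projector (R : realType) (H : normedModType R) (C : set H) (x : H) : H :=
  xget 0 [set p | C p /\ forall y, C y -> `|x - p| <= `|x - y|].

(* Metric subregularity of A at xbar for ubar \in A xbar, with constants kappa
   and delta. *)
Definition metrically_subregular (R : realType) (H : normedModType R)
    (A : H -> set H) (xbar ubar : H) (kappa delta : R) : Prop :=
  [/\ A xbar ubar, 0 < kappa, 0 < delta &
   forall x, closed_ball_ Num.norm xbar delta x ->
     (dist x (op_inv A ubar) <= kappa%:E * dist ubar (A x))%E].

(* For k = 0 the exponent k%:R^-1 is 0; this does not affect the limsup. *)
Definition R_linear_cvg (R : realType) (V : normedModType R) (y : nat -> V)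
    (ybar : V) : Prop :=
  y @ \oo --> ybar /\
  (limn_esup (fun k => (`|y k - ybar| `^ k%:R^-1)%:E) < 1)%E.

(* Main.v *)
(* The resolvent is handled through Minty's theorem, obtained by minimizing the
   Fitzpatrick function of [A] plus half the squared norm on [H * H]: at the
   minimizer [(x, u)], first-order optimality and maximality give [u = - x] and
   [A x (- x)].  For the algorithm, subregularity at [J x] yields
   [d(x) <= (1 + kappa / c) |x - J x|], while firm nonexpansiveness yields
   [|y - P x|^2 <= d(x)^2 - lambda (2 - lambda) |x - J x|^2]; together they give
   the one-step estimate (i), from which the rest follows by unrolling.  In the
   error-free case Fejer monotonicity bounds [|x_k - x_n|], [n >= k], by
   [2 d(x_k)], so the iterates are Cauchy. *)
Require Import Defs.
From HB Require Import structures.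
From mathcomp Require Import all_boot all_order all_algebra sesquilinear.
From mathcomp Require Import all_classical all_reals all_analysis.
From mathcomp Require Import ring lra.

Set Implicit Arguments.
Unset Strict Implicit.
Unset Printing Implicit Defensive.

Import Order.TTheory GRing.Theory Num.Theory.
Import numFieldNormedType.Exports.

Local Open Scope classical_set_scope.
Local Open Scope ring_scope.

(** * Scalar recursions and R-linear convergence *)

Lemma affine_recursion_le (R : realType) (D rho_ eps : nat -> R) :
  (forall k, 0 <= rho_ k) -> (forall k, D k.+1 <= rho_ k * D k + eps k) ->
  forall k, D k.+1 <= (\prod_(0 <= i < k.+1) rho_ i) * D 0%N
    + \sum_(0 <= i < k.+1) (\prod_(i.+1 <= j < k.+1) rho_ j) * eps i.
Proof.
move=> rho0 hD; elim=> [|k IHk].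
  by rewrite !big_nat1 big_geq// mul1r.
rewrite big_nat_recr//= [X in _ <= _ + X]big_nat_recr//= [X in _ + (_ + X * _)]big_geq//.
rewrite mul1r addrA (le_trans (hD _))// lerD2r.
rewrite [X in _ <= _ + X](eq_big_nat _ _ (F2 := fun i =>
  rho_ k.+1 * ((\prod_(i.+1 <= j < k.+1) rho_ j) * eps i))).
rewrite -mulr_sumr (mulrC _ (rho_ _)) -mulrA -mulrDr.
  exact: ler_wpM2l.
by move=> i /andP[_ ik]; rewrite big_nat_recr//= (mulrC _ (rho_ _)) mulrA.
Qed.

(** The factor [M] is absorbed by a ratio [s] strictly between [r] and 1: since [M * (r / s) ^+ n]
    tends to 0, eventually [M * r ^+ n <= s ^+ n], whose [n]-th root is [s]. *)
Lemma geometric_R_linear_cvg (R : realType) (V : normedModType R)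
    (y : nat -> V) (ybar : V) (M r : R) : 0 <= r < 1 ->
  (forall k, `|y k - ybar| <= M * r ^+ k) -> R_linear_cvg y ybar.
Proof.
move=> /andP[r0 r1] hy.
have geom s : 0 <= s < 1 -> s ^+ n @[n --> \oo] --> (0 : R).
  by move=> /andP[s0 s1]; apply: cvg_expr; rewrite ger0_norm.
split.
  apply/cvgrPdist_le => e e0.
  have : M * r ^+ n @[n --> \oo] --> (0 : R).
    by rewrite -[X in _ --> X](mulr0 M); apply: cvgMr; apply: geom; rewrite r0.
  move=> /cvgrPdist_le/(_ e e0); apply: filterS => n.
  rewrite sub0r normrN distrC => h; apply: le_trans (hy n) _.
  exact: le_trans (ler_norm _) h.
have [s [rs s1]] : exists s, r < s /\ s < 1 by exists ((r + 1) / 2); lra.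
have s0 : 0 < s by apply: le_lt_trans rs.
have : M * (r / s) ^+ n @[n --> \oo] --> (0 : R).
  rewrite -[X in _ --> X](mulr0 M); apply: cvgMr; apply: geom.
  by rewrite divr_ge0 ?(ltW s0)// ltr_pdivrMr// mul1r.
move=> /cvgrPdist_le/(_ 1 ltr01) [N _ hN].
rewrite /limn_esup limf_esupE; apply: (@le_lt_trans _ _ s%:E); last by rewrite lte_fin.
(* The tail starts at [N.+1] so as to exclude [n = 0], where the exponent is 0 and no root is
   taken. *)
apply: (@le_trans _ _ (ereal_sup ((fun k => (`|y k - ybar| `^ k%:R^-1)%:E)
    @` [set n | (N.+1 <= n)%N]))).
  apply: ereal_inf_lbound; exists [set n | (N.+1 <= n)%N] => //.
  exact: nbhs_infty_ge.
apply: ge_ereal_sup => _ [n /= Nn <-]; rewrite lee_fin.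
have n0 : n%:R != 0 :> R by rewrite pnatr_eq0 -lt0n (leq_trans _ Nn).
have -> : s = (s ^+ n) `^ n%:R^-1.
  by rewrite -powR_mulrn ?ltW// -powRrM mulfV// powRr1// ltW.
apply: ge0_ler_powR; rewrite ?invr_ge0 ?nnegrE ?exprn_ge0 ?(ltW s0)//.
apply: le_trans (hy n) _; have := hN n (ltnW Nn).
rewrite /= sub0r normrN => /(le_trans (ler_norm _)).
by rewrite expr_div_n mulrA ler_pdivrMr ?exprn_gt0// mul1r.
Qed.

Lemma prod_le_exp (R : realType) (f : nat -> R) (r : R) (m n : nat) :
  (forall k, 0 <= f k <= r) -> \prod_(m <= i < n) f i <= r ^+ (n - m).
Proof.
move=> hf; rewrite -prodr_const_nat; by apply: ler_prod => i _; exact: hf.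
Qed.

(** * The inner product and its continuity *)

Section HilbertSpace.
Variables (R : realType) (H : completeNormedModType R).
Variables (dot : {dot H for @idfun R}) (hdot : norm_induced_by dot).

Lemma dotC (u v : H) : dot u v = dot v u.
Proof. by rewrite hermC /= expr0 mul1r. Qed.

Lemma dotZr a (u v : H) : dot u (a *: v) = a * dot u v.
Proof. by rewrite linearZr. Qed.

Lemma dotDl (u v w : H) : dot (u + v) w = dot u w + dot v w.
Proof. by rewrite linearDl. Qed.

Lemma dotDr (u v w : H) : dot u (v + w) = dot u v + dot u w.
Proof. by rewrite linearDr. Qed.

Lemma dotNl (u v : H) : dot (- u) v = - dot u v.
Proof. by rewrite linearNl. Qed.

Lemma dotNr (u v : H) : dot u (- v) = - dot u v.
Proof. by rewrite linearNr. Qed.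

Lemma dot_sqr_norm (u : H) : dot u u = `|u| ^+ 2.
Proof.
rewrite hdot sqr_sqrtr//; have [->|u0] := eqVneq u 0.
  by rewrite linear0l.
exact/ltW/neq0_dnorm_gt0.
Qed.

Lemma sqr_normD (u v : H) :
  `|u + v| ^+ 2 = `|u| ^+ 2 + 2 * dot u v + `|v| ^+ 2.
Proof.
by rewrite -!dot_sqr_norm linearDl /= !linearDr /= (dotC v u); ring.
Qed.

(** Writing the dot product with norms alone reduces its continuity to that of the norm. *)
Lemma dot_polarization (u v : H) :
  dot u v = (`|u + v| ^+ 2 - `|u| ^+ 2 - `|v| ^+ 2) / 2.
Proof. by rewrite sqr_normD; field. Qed.

Lemma cvg_sqr_norm (u_ : nat -> H) (u : H) :
  u_ @ \oo --> u -> `|u_ n| ^+ 2 @[n --> \oo] --> `|u| ^+ 2.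
Proof. by move=> hu; rewrite expr2; apply: cvgM; apply: cvg_norm. Qed.

Lemma cvg_dot (u_ v_ : nat -> H) (u v : H) :
  u_ @ \oo --> u -> v_ @ \oo --> v ->
  dot (u_ n) (v_ n) @[n --> \oo] --> dot u v.
Proof.
move=> hu hv; rewrite dot_polarization; under eq_fun do rewrite dot_polarization.
apply: cvgMl; apply: cvgB; [apply: cvgB|]; apply: cvg_sqr_norm => //.
exact: cvgD.
Qed.

(** * Minimization of strongly convex functions *)

Lemma ge0_of_quadratic_ge0 (a b : R) :
  (forall s, 0 < s <= 1 -> 0 <= s * a + s ^+ 2 * b) -> 0 <= a.
Proof.
move=> h; rewrite leNgt; apply/negP => a0.
have den_gt0 : 0 < `|a| + `|b| + 1 by rewrite ltr_wpDl// addr_ge0.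
(* With this [s], the product of [s] and the absolute value of [b] stays below half the absolute
   value of [a], so a negative [a] would outweigh [s * b]. *)
set s := `|a| / (2 * (`|a| + `|b| + 1)).
have s_gt0 : 0 < s by rewrite divr_gt0// ?mulr_gt0// normr_gt0 lt_eqF.
have sE : s * (2 * (`|a| + `|b| + 1)) = `|a| by rewrite divfK// gt_eqF// mulr_gt0.
have b1 := ler_norm b; have b0 := normr_ge0 b.
have na : `|a| = - a by rewrite ltr0_norm.
have s1 : s <= 1 by rewrite ler_pdivrMr ?mulr_gt0// mul1r; lra.
have := h s; rewrite s_gt0 s1 => /(_ isT); rewrite expr2 -mulrA -mulrDr.
rewrite pmulr_rge0// => hs.
have : s * b <= s * `|b| by rewrite ler_pM2l.
have : 0 <= s * `|a| by rewrite mulr_ge0 // ltW.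
nra.
Qed.

Lemma cauchy_cvg_dominated (V : completeNormedModType R) (u : nat -> V)
    (g : nat -> R) :
  (forall n m, (n <= m)%N -> `|u n - u m| <= g n) ->
  g @ \oo --> 0 -> exists l : V, u @ \oo --> l.
Proof.
move=> hg g0; suff : cvgn u by move=> uc; exists (limn u).
apply/cauchy_cvgP/cauchy_exP => e e0.
have /cvgrPdist_lt/(_ e e0) [N _ hN] := g0.
exists (u N); exists N => // m /= Nm; rewrite -ball_normE /=.
apply: le_lt_trans (hg _ _ Nm) _.
have := hN N (leqnn N); rewrite /= sub0r normrN; exact/le_lt_trans/ler_norm.
Qed.

(* The triples [(p, u, t)] in [K] play the role of the epigraph of a convex
   function [f]; the lemma is the existence of a minimizer of the strongly
   convex function [f(p, u) + (|p|^2 + |u|^2) / 2], together with its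
   first-order optimality condition. *)
Lemma strongly_convex_minimizer (K : H -> H -> R -> Prop) :
  (exists p u t, K p u t) ->
  (forall p u t, K p u t -> 0 <= t + (`|p| ^+ 2 + `|u| ^+ 2) / 2) ->
  (forall s p u t p' u' t', 0 < s <= 1 -> K p u t -> K p' u' t' ->
     K (p + s *: (p' - p)) (u + s *: (u' - u)) (t + s * (t' - t))) ->
  (forall (p_ u_ : nat -> H) (t_ : nat -> R) p u t,
     (forall n, K (p_ n) (u_ n) (t_ n)) ->
     p_ @ \oo --> p -> u_ @ \oo --> u -> t_ @ \oo --> t -> K p u t) ->
  exists p u t, K p u t /\ forall p' u' t', K p' u' t' ->
    0 <= t' - t + dot p (p' - p) + dot u (u' - u).
Proof.
move=> [p1 [u1 [t1 K1]]] K_ge0 Kconv Kclosed.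
pose phi (p u : H) (t : R) := t + (`|p| ^+ 2 + `|u| ^+ 2) / 2.
pose S := [set r | exists p u t, K p u t /\ r = phi p u t].
have S_inf : has_inf S.
  split; first by exists (phi p1 u1 t1), p1, u1, t1.
  by exists 0 => _ [p [u [t [Kput ->]]]]; exact: K_ge0.
have inf_phi p u t : K p u t -> inf S <= phi p u t.
  by move=> Kput; apply: (ge_inf S_inf.2); exists p, u, t.
(* The expansion along a segment is exact; the coefficient of [s] is the expression in the
   optimality condition. *)
have expand s p u t p' u' t' :
    phi (p + s *: (p' - p)) (u + s *: (u' - u)) (t + s * (t' - t)) =
    phi p u t + s * (t' - t + dot p (p' - p) + dot u (u' - u))
    + s ^+ 2 * ((`|p' - p| ^+ 2 + `|u' - u| ^+ 2) / 2).
  rewrite /phi; move: (p' - p) (u' - u) => v w.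
  by rewrite !sqr_normD !dotZr !normrZ !exprMn real_normK ?num_real//; field.
(* At the midpoint, [phi] is the mean of its end values minus one eighth of the squared distance,
   and it is still at least [inf S]; hence the constant 8. Minimizing sequences are therefore
   Cauchy. *)
have contract p u t p' u' t' (r : R) : K p u t -> K p' u' t' ->
    phi p u t <= inf S + r -> phi p' u' t' <= inf S + r ->
    `|p' - p| ^+ 2 + `|u' - u| ^+ 2 <= 8 * r.
  move=> K1' K2 h1 h2.
  have half01 : 0 < (2^-1 : R) <= 1 by apply/andP; split; lra.
  have := inf_phi _ _ _ (Kconv _ _ _ _ _ _ _ half01 K1' K2).
  rewrite expand; have := expand 1 p u t p' u' t'.
  rewrite !scale1r !mul1r !subrKC expr1n mul1r => e1.
  by rewrite exprVn; lra.
have /boolp.choice [q hq] : forall n, exists q : H * H * R,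
    K q.1.1 q.1.2 q.2 /\ phi q.1.1 q.1.2 q.2 <= inf S + n.+1%:R^-1.
  move=> n.
  have [|_ [p [u [t [Kput ->]]]] /ltW hlt] := @inf_adherent _ S n.+1%:R^-1 _ S_inf.
    by rewrite invr_gt0.
  by exists (p, u, t).
have harm0 : (n.+1%:R^-1 : R) @[n --> \oo] --> (0 : R) by exact: cvg_harmonic.
have hq' n m : (n <= m)%N ->
    `|(q n).1.1 - (q m).1.1| ^+ 2 + `|(q n).1.2 - (q m).1.2| ^+ 2
      <= 8 * n.+1%:R^-1.
  move=> nm; have [Kn ln] := hq n; have [Km lm] := hq m.
  apply: (contract _ _ _ _ _ _ _ Km Kn _ ln); apply: le_trans lm _.
  by rewrite lerD2l lef_pV2 ?posrE ?ltr0n// ler_nat.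
have g0 : Num.sqrt (8 * n.+1%:R^-1 : R) @[n --> \oo] --> (0 : R).
  have h8 : (8 * n.+1%:R^-1 : R) @[n --> \oo] --> (0 : R).
    by rewrite -[X in _ --> X](mulr0 8); apply: cvgMr.
  rewrite -[X in _ --> X]sqrtr0; apply: (cvg_comp _ _ h8); exact: sqrt_continuous.
have [p cp] : exists p : H, (q n).1.1 @[n --> \oo] --> p.
  apply: cauchy_cvg_dominated g0 => n m /hq' h.
  rewrite -(ler_sqr) ?nnegrE ?sqrtr_ge0// sqr_sqrtr ?mulr_ge0 ?invr_ge0//.
  by apply: le_trans h; rewrite lerDl sqr_ge0.
have [u cu] : exists u : H, (q n).1.2 @[n --> \oo] --> u.
  apply: cauchy_cvg_dominated g0 => n m /hq' h.
  rewrite -(ler_sqr) ?nnegrE ?sqrtr_ge0// sqr_sqrtr ?mulr_ge0 ?invr_ge0//.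
  by apply: le_trans h; rewrite lerDr sqr_ge0.
have cphi : phi (q n).1.1 (q n).1.2 (q n).2 @[n --> \oo] --> inf S.
  apply: (@squeeze_cvgr _ _ _ _ (fun=> inf S) (fun n => inf S + n.+1%:R^-1)).
  - by apply: nearW => n; have [/inf_phi -> ->] := hq n.
  - exact: cvg_cst.
  - by rewrite -[X in _ --> X]addr0; apply: cvgD => //; exact: cvg_cst.
(* The Cauchy estimate controls only the first two components. The third converges because the
   values of [phi] and the norms do, and its limit is the height at which [phi p u t] equals
   [inf S]. *)
pose t := inf S - (`|p| ^+ 2 + `|u| ^+ 2) / 2.
have ct : (q n).2 @[n --> \oo] --> t.
  have -> : (fun n => (q n).2) = (fun n => phi (q n).1.1 (q n).1.2 (q n).2 -
      (`|(q n).1.1| ^+ 2 + `|(q n).1.2| ^+ 2) / 2).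
    by apply/funext => n; rewrite /phi addrK.
  apply: cvgB => //; apply: cvgMl; apply: cvgD; exact: cvg_sqr_norm.
have Kput : K p u t by apply: Kclosed cp cu ct => n; have [] := hq n.
exists p, u, t; split=> // p' u' t' K'.
apply: (@ge0_of_quadratic_ge0 _ ((`|p' - p| ^+ 2 + `|u' - u| ^+ 2) / 2)).
move=> s s01; have := inf_phi _ _ _ (Kconv _ _ _ _ _ _ _ s01 Kput K').
by rewrite expand [phi p u t]subrK -addrA lerDl.
Qed.

(** * Projection onto closed convex sets *)

(** The translate of [C] by [- x] has a point of least norm, found by the minimization lemma with
    [u] and [t] pinned to 0. So the set from which [projector] chooses is inhabited and its default
    value never arises. *)
Lemma projectorP (C : set H) (x : H) : C !=set0 ->
  (forall s p q, 0 < s <= 1 -> C p -> C q -> C (p + s *: (q - p))) ->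
  (forall (u : nat -> H) l, (forall n, C (u n)) -> u @ \oo --> l -> C l) ->
  C (projector C x) /\ forall y, C y -> `|x - projector C x| <= `|x - y|.
Proof.
move=> [c0 Cc0] Cconv Cclosed; rewrite /projector.
suff [p hp] : exists p, C p /\ forall y, C y -> `|x - p| <= `|x - y|.
  by case: xgetP => [_ _ //|/(_ p)]; case.
pose K (p u : H) (t : R) := C (x + p) /\ u = 0 /\ t = 0.
have [||||p [u [t [[Cp [-> ->]] hmin]]]] := strongly_convex_minimizer (K := K).
- by exists (c0 - x), 0, 0; rewrite /K subrKC.
- by move=> p u t [_ [-> ->]]; rewrite add0r divr_ge0// addr_ge0 ?sqr_ge0.
- move=> s p u t p' u' t' s01 [Cp [-> ->]] [Cp' [-> ->]]; split.
    have := Cconv s _ _ s01 Cp Cp'.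
    by rewrite opprD addrACA subrr add0r addrA.
  by rewrite !subrr scaler0 mulr0 !addr0.
- move=> p_ u_ t_ p u t hK hp hu ht; split; last split.
  + apply: (Cclosed (fun n => x + p_ n)); first by move=> n; case: (hK n).
    by apply: cvgD => //; exact: cvg_cst.
  + have u0 : u_ = cst 0 by apply/funext => n; case: (hK n) => _ [].
    apply: (cvg_unique _ hu) => //; rewrite u0; exact: cvg_cst.
  + have t0 : t_ = cst 0 by apply/funext => n; case: (hK n) => _ [].
    apply: (cvg_unique _ ht) => //; rewrite t0; exact: cvg_cst.
exists (x + p); split=> // y Cy.
have := hmin (y - x) 0 0; rewrite /K subrKC !subrr linear0r !add0r addr0.
move=> /(_ (conj Cy (conj erefl erefl))) h.
have -> : x - (x + p) = - p by rewrite opprD addNKr.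
rewrite distrC normrN -ler_sqr ?nnegrE//.
(* Optimality says that [dot p (y - x - p)] is nonnegative, so expanding the square of
   [p + (y - x - p)] leaves at least the square of the norm of [p]. *)
rewrite -(subrK p (y - x)) addrC sqr_normD -addrA lerDl.
by rewrite addr_ge0 ?sqr_ge0// mulr_ge0.
Qed.

(** * Maximality, Minty's theorem and the resolvent *)

(** Adjoining [(x, u)] to the graph keeps it monotone, so by maximality the pair was already
    there. *)
Lemma maximally_monotone_graph (A : H -> set H) (x u : H) :
  maximally_monotone dot A ->
  (forall y v, A y v -> 0 <= dot (x - y) (u - v)) -> A x u.
Proof.
move=> [Amon Amax] hxu.
apply: (Amax (fun a => A a `|` [set w | a = x /\ w = u])).
- move=> a b v w [Aav|[/= -> ->]] [Abw|[/= -> ->]].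
  + exact: Amon.
  + by rewrite -opprB -(opprB u) linearNl linearNr opprK; exact: hxu.
  + exact: hxu.
  + by rewrite !subrr linear0l.
- by move=> a v; left.
- by right.
Qed.

(* [K] below is the epigraph of the Fitzpatrick function of [A], which
   dominates the duality pairing because [A] is maximally monotone. *)
Lemma minty_at0 (A : H -> set H) : monotone_op dot A ->
  (forall x u, (forall y v, A y v -> 0 <= dot (x - y) (u - v)) -> A x u) ->
  (exists y v, A y v) -> exists x, A x (- x).
Proof.
move=> Amon Amax [y0 [v0 Ayv0]].
pose K (x u : H) (t : R) :=
  forall y v, A y v -> dot x v + dot y u - dot y v <= t.
have dotBB (a b u v : H) :
    dot (a - b) (u - v) = dot a u - dot a v - dot b u + dot b v.
  by rewrite linearBl /= !linearBr /=; ring.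
(* If [t < dot x u], the bounds in [K] make [(x, u)] monotonically related to the graph, hence a
   point of it; the bound at that very point then gives [dot x u <= t]. *)
have K_ge x u t : K x u t -> dot x u <= t.
  move=> Kxut; rewrite leNgt; apply/negP => tlt.
  have Axu : A x u.
    by apply: Amax => y v Ayv; rewrite dotBB; have := Kxut y v Ayv; lra.
  by have := Kxut x u Axu; rewrite addrK leNgt tlt.
have [||||x [u [t [Kxut hmin]]]] := strongly_convex_minimizer (K := K).
- exists y0, v0, (dot y0 v0) => y v Ayv.
  by have := Amon _ _ _ _ Ayv0 Ayv; rewrite dotBB; lra.
- move=> p u t /K_ge; have := sqr_normD p u; have := sqr_ge0 `|p + u|; lra.
- move=> s p u t p' u' t' /andP[s0 s1] Kp Kp' y v Ayv.
  have := Kp _ _ Ayv; have := Kp' _ _ Ayv.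
  rewrite linearDl !linearDr /= !dotZr (dotC (_ *: _)) dotZr !linearBr /=.
  rewrite !(dotC v); nra.
- move=> p_ u_ t_ p u t hK hp hu ht y v Ayv.
  apply: ler_cvg_to _ ht (nearW _ (fun n => hK n _ _ Ayv)).
  apply: cvgB; last exact: cvg_cst.
  by apply: cvgD; apply: cvg_dot => //; exact: cvg_cst.
(* Graph points, at height [dot y v], serve as competitors in the optimality condition; [K_ge] at
   the minimizer completes the square. *)
have key y v : A y v -> `|x + u| ^+ 2 <= dot (y + u) (v + x).
  move=> Ayv; have Kyv : K y v (dot y v).
    by move=> z w Azw; have := Amon _ _ _ _ Ayv Azw; rewrite dotBB; lra.
  have := hmin _ _ _ Kyv; have := K_ge _ _ _ Kxut.
  rewrite (sqr_normD x u) dotDl !dotDr !dotNr !dot_sqr_norm.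
  rewrite (dotC x y) (dotC u x); lra.
(* By [key], the pair [(- u, - x)] is monotonically related to the graph. Feeding it back into [key]
   makes the right-hand side 0 and forces [u = - x]. *)
have Aux : A (- u) (- x).
  apply: Amax => y v /key; rewrite -opprD -(opprD x) linearNl linearNr /= opprK.
  by rewrite (addrC u) (addrC x v); apply: le_trans; exact: sqr_ge0.
have := key _ _ Aux; rewrite addNr linear0l => xu0.
have /eqP : `|x + u| ^+ 2 = 0 by apply/eqP; rewrite eq_le xu0 sqr_ge0.
rewrite sqrf_eq0 normr_eq0 addr_eq0 => /eqP xu.
by exists x; move: Aux; rewrite -xu.
Qed.

(** Apply [minty_at0] to the translated and scaled operator sending [x] to [gamma] times
    [A (x + z)]; the point found there, shifted by [z], is [p]. *)
Lemma minty (A : H -> set H) (gamma : R) (z : H) :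
  maximally_monotone dot A -> (exists y v, A y v) -> 0 < gamma ->
  exists p, A p (gamma^-1 *: (z - p)).
Proof.
move=> Amax [y0 [v0 A0]] gamma0.
have gi0 : 0 <= gamma^-1 by rewrite invr_ge0 ltW.
have [|||x] := @minty_at0 (fun x => [set u | A (x + z) (gamma^-1 *: u)]).
- move=> x y u v /= Ax Ay.
  have := Amax.1 _ _ _ _ Ax Ay.
  by rewrite opprD addrACA subrr addr0 -scalerBr dotZr pmulr_rge0// invr_gt0.
- move=> x u h; apply: (maximally_monotone_graph Amax) => y v Ayv.
  have := h (y - z) (gamma *: v).
  rewrite /= subrK scalerA mulVf ?gt_eqF// scale1r => /(_ Ayv) h'.
  have -> : gamma^-1 *: u - v = gamma^-1 *: (u - gamma *: v).
    by rewrite scalerBr scalerA mulVf ?gt_eqF// scale1r.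
  by rewrite dotZr mulr_ge0//; move: h'; rewrite opprB addrA.
- by exists (y0 - z), (gamma *: v0); rewrite /= subrK scalerA mulVf ?gt_eqF// scale1r.
by move=> /= Ax; exists (x + z); rewrite opprD addrCA subrr addr0.
Qed.

(** Minty's theorem rules out the default value in [resolvent]; the chosen [p] solves
    [p + gamma *: u = x] for some [u] in [A p], which determines [u]. *)
Lemma resolventP (A : H -> set H) (gamma : R) (x : H) :
  maximally_monotone dot A -> (exists y v, A y v) -> 0 < gamma ->
  A (resolvent gamma A x) (gamma^-1 *: (x - resolvent gamma A x)).
Proof.
move=> Amax A0 gamma0; rewrite /resolvent.
have [p Ap] := minty x Amax A0 gamma0.
case: xgetP => [q _ [u Aqu <-]|/(_ p)[]].
  by rewrite addrC addKr scalerA mulVf ?gt_eqF// scale1r.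
exists (gamma^-1 *: (x - p)) => //.
by rewrite scalerA divff ?gt_eqF// scale1r subrKC.
Qed.

(** * The set of zeros *)

(** By maximality, [zer A] is an intersection of closed half-spaces [0 <= dot (p - y) (0 - v)] over
    the graph points [(y, v)]. Closedness below has the same source. *)
Lemma zer_convex (A : H -> set H) (s : R) (p q : H) :
  maximally_monotone dot A -> 0 < s <= 1 -> zer A p -> zer A q ->
  zer A (p + s *: (q - p)).
Proof.
move=> Amax /andP[s0 s1] Ap Aq; apply: (maximally_monotone_graph Amax) => y v Ayv.
move: (Amax.1 _ _ _ _ Ap Ayv) (Amax.1 _ _ _ _ Aq Ayv).
have -> : p + s *: (q - p) - y = (p - y) + s *: ((q - y) - (p - y)).
  by rewrite opprB addrA subrK addrAC.
move=> h1 h2; rewrite dotDl (dotC (s *: _)) dotZr (dotC (0 - v)) (dotDl (q - y)) (dotNl (p - y)).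
nra.
Qed.

Lemma zer_closed (A : H -> set H) (u : nat -> H) (l : H) :
  maximally_monotone dot A -> (forall n, zer A (u n)) -> u @ \oo --> l ->
  zer A l.
Proof.
move=> Amax Au ul; apply: (maximally_monotone_graph Amax) => y v Ayv.
have h : dot (u n - y) (0 - v) @[n --> \oo] --> dot (l - y) (0 - v).
  by apply: cvg_dot; [apply: cvgB => //|]; exact: cvg_cst.
by apply: (cvgr_to_ge h); apply: nearW => n; exact: (Amax.1 _ _ _ _ (Au n) Ayv).
Qed.

(** * One relaxed resolvent step *)

Section Iteration.
Variables (A : H -> set H) (hA : maximally_monotone dot A) (hzer : zer A !=set0).

Let A_nonempty : exists y v, A y v.
Proof. by have [z Az] := hzer; exists z, 0. Qed.

Lemma zer_projectorP (x : H) :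
  zer A (projector (zer A) x) /\
  forall y, zer A y -> `|x - projector (zer A) x| <= `|x - y|.
Proof.
apply: projectorP => //; first by move=> *; exact: zer_convex.
by move=> u l; exact: zer_closed.
Qed.

Lemma dist_zer (x : H) : dist x (zer A) = `|x - projector (zer A) x|%:E.
Proof.
have [zp zmin] := zer_projectorP x; apply/eqP; rewrite eq_le; apply/andP; split.
  by apply: ereal_inf_lbound; exists (projector (zer A) x).
by apply: le_ereal_inf_tmp => _ [y zy <-]; rewrite lee_fin; exact: zmin.
Qed.

(** Monotonicity between [p] and the zero [z] gives [0 <= dot (p - z) (x - p)]. This bounds the
    cross term in the expansion of the square of [(x - z) + l *: (p - x)]. *)
Lemma relaxed_resolvent_sqr_le (g l : R) (x z : H) : 0 < g -> 0 <= l -> zer A z ->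
  `|(1 - l) *: x + l *: resolvent g A x - z| ^+ 2
    <= `|x - z| ^+ 2 - l * (2 - l) * `|x - resolvent g A x| ^+ 2.
Proof.
move=> g0 l0 zz; set p := resolvent g A x.
have pxz : 0 <= dot (p - z) (x - p).
  have := hA.1 _ _ _ _ (resolventP x hA A_nonempty g0) zz.
  by rewrite subr0 dotZr pmulr_rge0// invr_gt0.
have -> : (1 - l) *: x + l *: p - z = (x - z) + l *: (p - x).
  rewrite scalerBl scale1r scalerBr -!addrA; congr (_ + _).
  by rewrite addrC -addrA addrCA.
have : dot (x - z) (p - x) <= - `|x - p| ^+ 2.
  have -> : x - z = (p - z) + (x - p) by rewrite [RHS]addrC addrA subrK.
  by rewrite -(opprB x p) dotNr dotDl dot_sqr_norm lerN2 lerDr.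
rewrite (sqr_normD (x - z)) dotZr normrZ exprMn real_normK ?num_real// (distrC p).
have := sqr_ge0 `|x - p|; nra.
Qed.

Lemma relaxed_resolvent_norm_le (g l : R) (x z : H) :
  0 < g -> 0 <= l <= 2 -> zer A z ->
  `|(1 - l) *: x + l *: resolvent g A x - z| <= `|x - z|.
Proof.
move=> g0 /andP[l0 l2] zz; rewrite -ler_sqr ?nnegrE//.
apply: le_trans (relaxed_resolvent_sqr_le _ g0 l0 zz) _.
by rewrite gerBl mulr_ge0 ?sqr_ge0// mulr_ge0// subr_ge0.
Qed.

Lemma resolvent_dist_le (g : R) (x z : H) : 0 < g -> zer A z ->
  `|resolvent g A x - z| <= `|x - z|.
Proof.
move=> g0 zz; have := @relaxed_resolvent_norm_le g 1 x z g0.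
by rewrite subrr scale0r add0r scale1r; apply => //; rewrite ler01 ler1n.
Qed.

(** * Contraction under metric subregularity *)

Variables (xbar : H) (kappa delta : R).
Hypotheses (hsub : metrically_subregular A xbar 0 kappa delta).

(** The resolvent point [p] is no farther from [xbar] than [x], so subregularity applies at [p]; the
    element [g^-1 *: (x - p)] of [A p] bounds the distance from 0 to [A p]. The triangle inequality
    through [p] supplies the summand 1. *)
Lemma subregular_dist_le (g : R) (x : H) : 0 < g -> `|x - xbar| <= delta ->
  `|x - projector (zer A) x| <= (1 + kappa / g) * `|x - resolvent g A x|.
Proof.
move=> g0 xdelta; have [zbar kappa0 _ sub] := hsub.
set p := resolvent g A x.
have pA : A p (g^-1 *: (x - p)) by exact: resolventP.
have /sub : closed_ball_ Num.norm xbar delta p.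
  by rewrite /closed_ball_ /= distrC (le_trans (resolvent_dist_le _ g0 zbar)).
rewrite -/(zer A) dist_zer => h.
have {}h : `|p - projector (zer A) p| <= kappa * (g^-1 * `|x - p|).
  rewrite -lee_fin (le_trans h)// EFinM lee_pmul2l ?lte_fin//.
  apply: ereal_inf_lbound; exists (g^-1 *: (x - p)) => //.
  by rewrite sub0r normrN normrZ gtr0_norm ?invr_gt0.
have [zp _] := zer_projectorP p.
apply: le_trans ((zer_projectorP x).2 _ zp) _.
apply: le_trans (ler_distD p _ _) _.
by rewrite mulrDl mul1r lerD2l -mulrA.
Qed.

Lemma subregular_step (g l : R) (x : H) : 0 < g -> 0 <= l <= 2 ->
  `|x - xbar| <= delta ->
  `|(1 - l) *: x + l *: resolvent g A x - projector (zer A) x| ^+ 2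
    <= (1 - l * (2 - l) / (1 + kappa / g) ^+ 2)
       * `|x - projector (zer A) x| ^+ 2.
Proof.
move=> g0 /andP[l0 l2] xdelta; have [_ kappa0 _ _] := hsub.
have G0 : 0 < 1 + kappa / g by rewrite addr_gt0// divr_gt0.
apply: le_trans (relaxed_resolvent_sqr_le _ g0 l0 (zer_projectorP x).1) _.
rewrite mulrBl mul1r lerB// -(mulrA (l * (2 - l))) ler_wpM2l ?mulr_ge0 ?subr_ge0//.
rewrite mulrC ler_pdivrMr ?exprn_gt0// mulrC -exprMn.
rewrite ler_sqr ?nnegrE ?mulr_ge0 ?(ltW G0)//.
exact: subregular_dist_le.
Qed.

End Iteration.
End HilbertSpace.

(** * Convergence of the inexact relaxed proximal point algorithm *)

Theorem theorem5p12 (R : realType) (H : completeNormedModType R)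
  (dot : {dot H for @idfun R}) (hdot : norm_induced_by dot)
  (A : H -> set H) (hA : maximally_monotone dot A) (hzer : zer A !=set0)
  (lambda eta c : nat -> R) (e x : nat -> H)
  (hlambda : forall k, 0 <= lambda k <= 2)
  (heta : forall k, 0 <= eta k)
  (hc : forall k, 0 < c k)
  (hx : forall k, x k.+1 =
     (1 - lambda k) *: x k + lambda k *: resolvent (c k) A (x k)
     + eta k *: e k)
  (xbar : H) (hxbar : zer A xbar)
  (kappa delta : R) (hsub : metrically_subregular A xbar 0 kappa delta)
  (hcinf : 0 < inf (range c))
  (hsum : (\sum_(0 <= k <oo) (eta k * `|e k|)%:E < delta%:E)%E)
  (tau : R) (htau0 : 0 < tau)
  (htau : (tau%:E <= delta%:E - \sum_(0 <= k <oo) (eta k * `|e k|)%:E)%E)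
  (hx0 : closed_ball_ Num.norm xbar tau (x 0%N)) :
  let y k := (1 - lambda k) *: x k + lambda k *: resolvent (c k) A (x k) in
  let eps k :=
    eta k * `|e k| * (2 * `|y k - projector (zer A) (x k)| + eta k * `|e k|) in
  let gamma k := 1 + kappa / c k in
  let beta k := lambda k * (2 - lambda k) / gamma k ^+ 2 in
  let rho_ k := 1 - beta k in
  let rho := sup (range rho_) in
  let lambda_inf := inf (range lambda) in
  let lambda_sup := sup (range lambda) in
  let d k := dist (x k) (zer A) in
  [/\ (* (i) *)
      forall k, 0 <= rho_ k <= 1 /\
        (d k.+1 ^+ 2 <= (rho_ k)%:E * d k ^+ 2 + (eps k)%:E)%E,
      (* (ii) *)
      forall k,
        (d k.+1 ^+ 2 <=
          (\prod_(0 <= i < k.+1) rho_ i)%:E * d 0%N ^+ 2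
          + (\sum_(0 <= i < k.+1)
               (\prod_(i.+1 <= j < k.+1) rho_ j) * eps i)%:E)%E,
      (* (iii) *)
      0 < lambda_inf /\ lambda_inf <= lambda_sup /\ lambda_sup < 2 ->
      [/\ (* (a) *)
          0 <= rho /\
          rho <= 1 - lambda_inf * (2 - lambda_sup)
                     / (1 + kappa / inf (range c)) ^+ 2 /\
          1 - lambda_inf * (2 - lambda_sup)
              / (1 + kappa / inf (range c)) ^+ 2 < 1,
          (* (b) *)
          forall k,
            (d k.+1 ^+ 2 <=
              (rho ^+ k)%:E *
                (rho%:E * d 0%N ^+ 2
                 + (\sum_(0 <= i < k.+1) eps i / rho ^+ i)%:E))%E
        & (\sum_(0 <= k <oo) (eps k / rho ^+ k)%:E < +oo)%E ->
          (* d is finite, since zer A is nonempty *)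
          R_linear_cvg (fun k => fine (d k ^+ 2)%E : R^o) 0]
    & (* (iv) *)
      0 < lambda_inf /\ lambda_inf <= lambda_sup /\ lambda_sup < 2 ->
      (forall k, e k = 0 /\ eta k = 0) ->
      (* (a) *)
      (forall k, (d k.+1 <= (Num.sqrt (rho_ k))%:E * d k)%E) /\
      (* (b) *)
      (exists2 xhat, zer A xhat &
        (forall k,
           (`|x k - xhat|%:E <= (2 * rho `^ (k%:R / 2))%:E * d 0%N)%E) /\
        R_linear_cvg x xhat)].
Proof.
move=> y eps gamma beta rho_ rho lambda_inf lambda_sup d.
have [zbar kappa0 _ _] := hsub.
pose D k := `|x k - projector (zer A) (x k)|.
have D_ge0 k : 0 <= D k by exact: normr_ge0.
have dE k : d k = (D k)%:E by exact: dist_zer.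
have zP k := zer_projectorP hdot hA hzer (x k).
have eta_e k : `|eta k *: e k| = eta k * `|e k| by rewrite normrZ ger0_norm.
have etae_ge0 k : 0 <= eta k * `|e k| by rewrite mulr_ge0.
have xS k : x k.+1 = y k + eta k *: e k by exact: hx.
have y_le k z : zer A z -> `|y k - z| <= `|x k - z|.
  by move=> zz; exact: relaxed_resolvent_norm_le.
(* Before the error is added, a step does not increase the distance to [xbar]; the accumulated
   errors fit in the slack between [tau] and [delta], so subregularity is available at every
   iterate. *)
have ball k : `|x k - xbar| <= delta.
  suff : `|x k - xbar| <= tau + \sum_(0 <= i < k) eta i * `|e i|.
    move=> /le_trans; apply; rewrite -lee_fin EFinD -leeBrDr//.
    apply: le_trans htau _; apply: leeB => //; rewrite -sumEFin.
    by apply: nneseries_lim_ge => n _ _; rewrite lee_fin.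
  elim: k => [|k IHk].
    by rewrite big_geq// addr0 distrC.
  rewrite xS addrAC (le_trans (ler_normD _ _))//.
  by rewrite big_nat_recr//= addrA eta_e lerD2r (le_trans (y_le _ _ zbar)).
have gamma_gt1 k : 1 < gamma k by rewrite ltrDl divr_gt0.
(* Here [lambda k * (2 - lambda k)] is 1 minus a square, while [gamma k ^+ 2] exceeds 1. Strictness
   makes [rho_ k], and hence [rho], positive, so the divisions by [rho ^+ i] are genuine. *)
have beta_bnd k : 0 <= beta k < 1.
  have /andP[l0 l2] := hlambda k.
  have G2 : 1 < gamma k ^+ 2 by rewrite exprn_egt1.
  have G2p := lt_trans ltr01 G2; apply/andP; split.
    by apply: divr_ge0; [rewrite mulr_ge0 ?subr_ge0|exact: ltW].
  rewrite ltr_pdivrMr// mul1r (le_lt_trans _ G2)//.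
  by have := sqr_ge0 (1 - lambda k); nra.
have rho_bnd k : 0 < rho_ k <= 1.
  by have := beta_bnd k; rewrite /rho_ subr_gt0 gerBl andbC.
have rho_ge0 k : 0 <= rho_ k by case/andP: (rho_bnd k) => /ltW.
have y_sqr_le k : `|y k - projector (zer A) (x k)| ^+ 2 <= rho_ k * D k ^+ 2.
  exact: (subregular_step hdot hA hzer hsub).
have D_step k : D k.+1 ^+ 2 <= rho_ k * D k ^+ 2 + eps k.
  (* The projection of [x k] is a competitor for the distance from [x k.+1]; squaring this bound
     produces [eps k] as the cross term plus the squared error. *)
  have h1 : D k.+1 <= `|y k - projector (zer A) (x k)| + eta k * `|e k|.
    apply: le_trans ((zP k.+1).2 _ (zP k).1) _.
    by rewrite xS addrAC -eta_e ler_normD.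
  have : D k.+1 ^+ 2 <= (`|y k - projector (zer A) (x k)| + eta k * `|e k|) ^+ 2.
    by rewrite ler_sqr ?nnegrE ?addr_ge0 ?D_ge0.
  have := y_sqr_le k; rewrite /eps; nra.
have D_prod := affine_recursion_le (D := fun k => D k ^+ 2) rho_ge0 D_step.
have rho_ub : has_ubound (range rho_).
  by exists 1 => _ [k _ <-]; case/andP: (rho_bnd k).
have rho_le k : rho_ k <= rho by apply: ub_le_sup => //; exists k.
have rho_gt0 : 0 < rho by apply: lt_le_trans (rho_le 0%N); case/andP: (rho_bnd 0%N).
have eps_ge0 k : 0 <= eps k by rewrite mulr_ge0// addr_ge0// mulr_ge0.
have rho_facts : 0 < lambda_inf /\ lambda_inf <= lambda_sup /\ lambda_sup < 2 ->
    rho <= 1 - lambda_inf * (2 - lambda_sup) / (1 + kappa / inf (range c)) ^+ 2 /\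
    1 - lambda_inf * (2 - lambda_sup) / (1 + kappa / inf (range c)) ^+ 2 < 1.
  move=> [linf0 [_ lsup2]].
  have G0 : 0 < 1 + kappa / inf (range c) by rewrite addr_gt0// divr_gt0.
  split; last first.
    by rewrite gtrBl divr_gt0 ?exprn_gt0// mulr_gt0// subr_gt0.
  apply: ge_sup; first by exists (rho_ 0%N), 0%N.
  move=> _ [k _ <-]; rewrite lerB//.
  have /andP[l0 l2] := hlambda k.
  have linf : lambda_inf <= lambda k.
    apply: ge_inf; last by exists k.
    by exists 0 => _ [j _ <-]; case/andP: (hlambda j).
  have lsup : lambda k <= lambda_sup.
    apply: ub_le_sup; last by exists k.
    by exists 2 => _ [j _ <-]; case/andP: (hlambda j).
  have cinf : inf (range c) <= c k.
    apply: ge_inf; last by exists k.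
    by exists 0 => _ [j _ <-]; exact: ltW.
  have gk := gamma_gt1 k; have gk0 := lt_trans ltr01 gk.
  (* The numerator is compared factor by factor; the denominator uses that [kappa / c k] is largest
     at the infimum of [c]. *)
  apply: ler_pM.
  - by apply: mulr_ge0; rewrite ?subr_ge0; exact: ltW.
  - by rewrite invr_ge0 exprn_ge0// ltW.
  - by apply: ler_pM; rewrite ?subr_ge0 ?lerB// ltW.
  rewrite lef_pV2 ?posrE ?exprn_gt0// ler_sqr ?nnegrE ?(ltW gk0) ?(ltW G0)//.
  by rewrite lerD2l ler_pM2l// lef_pV2 ?posrE.
have D_rho k : D k.+1 ^+ 2 <= rho ^+ k *
    (rho * D 0%N ^+ 2 + \sum_(0 <= i < k.+1) eps i / rho ^+ i).
  apply: le_trans (D_prod k) _; rewrite mulrDr mulrA -exprSr mulr_sumr.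
  have rho_nn j : 0 <= rho_ j <= rho by rewrite rho_le ltW//; case/andP: (rho_bnd j).
  apply: lerD.
    by rewrite ler_wpM2r ?sqr_ge0// -[k.+1 in leRHS]subn0; exact: prod_le_exp.
  (* The product after index [i] has [k - i] factors, so it is at most [rho ^+ k / rho ^+ i]. *)
  apply: ler_sum_nat => i /andP[_ ik].
  rewrite [leRHS]mulrCA [leLHS]mulrC ler_wpM2l// -exprB ?unitfE ?gt_eqF//.
  by rewrite -subSS; exact: prod_le_exp.
split.
- move=> k; split; first by case/andP: (rho_bnd k) => /ltW -> ->.
  by rewrite !dE -!EFin_expe -EFinM -EFinD lee_fin.
- by move=> k; rewrite !dE -!EFin_expe -EFinM -EFinD lee_fin.
- move=> hl; have [rho1 rho2] := rho_facts hl; split=> [|k|hS].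
  + by rewrite ltW.
  + by rewrite !dE -!EFin_expe -(EFinM rho) -EFinD -EFinM lee_fin.
  have S_ge0 k : 0 <= eps k / rho ^+ k by rewrite divr_ge0// exprn_ge0// ltW.
  pose S := fine (\sum_(0 <= k <oo) (eps k / rho ^+ k)%:E)%E.
  have S_ub k : \sum_(0 <= i < k) eps i / rho ^+ i <= S.
    rewrite -lee_fin fineK; last first.
      by rewrite ge0_fin_numE//; apply: nneseries_ge0 => n _ _; rewrite lee_fin.
    by rewrite -sumEFin; apply: nneseries_lim_ge => n _ _; rewrite lee_fin.
  (* The bound at [k.+1] carries only [rho ^+ k] in front of [S]; the missing factor is compensated
     by dividing [S] by [rho]. *)
  apply: (@geometric_R_linear_cvg _ _ _ _ (D 0%N ^+ 2 + S / rho) rho).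
    by rewrite ltW//= (le_lt_trans rho1).
  move=> k; rewrite subr0 dE -EFin_expe /= ger0_norm ?sqr_ge0//.
  have S0 : 0 <= S by have := S_ub 0%N; rewrite big_geq.
  case: k => [|k].
    by rewrite expr0 mulr1 lerDl divr_ge0// ltW.
  apply: le_trans (D_rho k) _.
  have -> : (D 0%N ^+ 2 + S / rho) * rho ^+ k.+1 = rho ^+ k * (rho * D 0%N ^+ 2 + S).
    by rewrite (exprS rho); field; rewrite gt_eqF.
  by rewrite ler_wpM2l ?exprn_ge0 ?(ltW rho_gt0)// lerD2l.
move=> hl he; have [rho1 rho2] := rho_facts hl.
have rho_lt1 : rho < 1 by exact: le_lt_trans rho1 rho2.
have eps0 k : eps k = 0 by rewrite /eps; have [_ ->] := he k; rewrite !mul0r.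
have Dsqrt k : D k.+1 <= Num.sqrt (rho_ k) * D k.
  have r0 : 0 <= rho_ k by case/andP: (rho_bnd k) => /ltW.
  rewrite -ler_sqr ?nnegrE ?mulr_ge0 ?sqrtr_ge0 ?D_ge0// exprMn sqr_sqrtr//.
  by have := D_step k; rewrite eps0 addr0.
have Dexp k : D k <= Num.sqrt rho ^+ k * D 0%N.
  elim: k => [|k IHk]; first by rewrite expr0 mul1r.
  apply: le_trans (Dsqrt k) _; rewrite exprS -mulrA.
  by apply: ler_pM; rewrite ?sqrtr_ge0 ?D_ge0// ler_wsqrtr.
have fejer z n m : zer A z -> (n <= m)%N -> `|x m - z| <= `|x n - z|.
  move=> zz /subnK <-; elim: (m - n)%N => [//|j IHj]; rewrite addSn.
  apply: le_trans IHj; rewrite xS; have [_ ->] := he (j + n)%N.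
  by rewrite scale0r addr0; exact: y_le.
(* Both [x n] and the later [x m] lie within [D n] of the projection of [x n], the latter by Fejer
   monotonicity. *)
have x_cauchy n m : (n <= m)%N -> `|x n - x m| <= 2 * D n.
  move=> nm; apply: le_trans (ler_distD (projector (zer A) (x n)) _ _) _.
  rewrite mulr_natl mulr2n lerD2l distrC; apply: fejer => //; exact: (zP n).1.
have sqrt01 : 0 <= Num.sqrt rho < 1.
  by rewrite sqrtr_ge0/= -sqrtr1 ltr_sqrt.
have geom0 : Num.sqrt rho ^+ n * D 0%N @[n --> \oo] --> (0 : R).
  rewrite -[X in _ --> X](mul0r (D 0%N)); apply: cvgMl; apply: cvg_expr.
  by have /andP[s0 s1] := sqrt01; rewrite ger0_norm.
have [xhat x_xhat] : exists l : H, x @ \oo --> l.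
  apply: (@cauchy_cvg_dominated _ _ _ (fun n => 2 * (Num.sqrt rho ^+ n * D 0%N))).
    by move=> n m nm; apply: le_trans (x_cauchy n m nm) _; rewrite ler_pM2l.
  by rewrite -[X in _ --> X](mulr0 2); apply: cvgMr.
have x_dist k : `|x k - xhat| <= 2 * D k.
  have : `|x k - x n| @[n --> \oo] --> `|x k - xhat|.
    by apply: cvg_norm; apply: cvgB => //; exact: cvg_cst.
  by move=> /cvgr_to_le; apply; exists k => // n /= kn; exact: x_cauchy.
have powE k : rho `^ (k%:R / 2) = Num.sqrt rho ^+ k.
  by rewrite mulrC powRrM powR12_sqrt ?ltW// powR_mulrn.
have x_geom k : `|x k - xhat| <= 2 * D 0%N * Num.sqrt rho ^+ k.
  by apply: le_trans (x_dist k) _; rewrite -mulrA (mulrC (D _)) ler_pM2l.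
split; first by move=> k; rewrite !dE -EFinM lee_fin.
exists xhat.
  (* The projections are zeros of [A] and share the limit of the iterates because [D n] tends to 0;
     closedness of [zer A] then puts [xhat] in it. *)
  have P0 : projector (zer A) (x n) @[n --> \oo] --> xhat.
    have D0 : D n @[n --> \oo] --> (0 : R).
      apply: (@squeeze_cvgr _ _ _ _ (fun=> 0) (fun n => Num.sqrt rho ^+ n * D 0%N)).
      - by apply: nearW => n; rewrite D_ge0 Dexp.
      - exact: cvg_cst.
      - exact: geom0.
    have -> : (fun n => projector (zer A) (x n)) =
        (fun n => x n - (x n - projector (zer A) (x n))).
      by apply/funext => n; rewrite subKr.
    by rewrite -[X in _ --> X]subr0; apply: cvgB => //; exact: norm_cvg0.
  exact: (zer_closed hdot hA (fun n => (zP n).1) P0).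
split; last exact: geometric_R_linear_cvg x_geom.
by move=> k; rewrite dE powE -EFinM lee_fin mulrAC.
Qed.
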